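(* Let $P$ be a finite poset with minimum $\hat 0$ and let $\phi:\phi(0)=\hat 0<\phi(1)<\dots<\phi(n-1)$ be a chain in $P$. Then the lattice $\mathrm{Tam}(P,\phi)$ is join-semidistributive. Moreover, $\mathrm{Tam}(P,\phi)$ is semidistributive if and only if every element of $I_P(\phi(n-1))$ is comparable to every element of the chain $\phi$.
   Context: For $x\in P$, $I_P(x)=\{y\in P\mid y\le x\}$. For $0\le k<n$ let $\mathcal C_k:=I_P(\phi(k))\times\{k\}$, and let $\mathcal C_P^\phi:=\bigsqcup_{k<n}\mathcal C_k$ be the disjoint union of posets, i.e. $(x,i)\le(y,j)$ iff $i=j$ and $x\le y$ in $P$. An order filter of $\mathcal C_P^\phi$ is an up-closed subset for this order. An order filter $F$ of $\mathcal C_P^\phi$ is torclosed if for all $i<j<n$: $(x,i)\in F$ and $(\phi(i+1),j)\in F$ imply $(x,j)\in F$. $\mathrm{Tam}(P,\phi)$ is the set of torclosed subsets of $\mathcal C_P^\phi$ ordered by inclusion; it is a finite lattice whose meet is intersection. A lattice is join-semidistributive if $x\vee y=x\vee z$ implies $x\vee(y\wedge z)=x\vee y$; meet-semidistributive is the dual condition; semidistributive means both. *)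

(* Defs.v *)
From HB Require Import structures.
From mathcomp Require Import all_boot all_order.

Set Implicit Arguments.
Unset Strict Implicit.
Unset Printing Implicit Defensive.

Import Order.TTheory.
Local Open Scope order_scope.

Definition join_semidistributive d (L : latticeType d) : Prop :=
  forall x y z : L, x `|` y = x `|` z -> x `|` (y `&` z) = x `|` y.

Definition meet_semidistributive d (L : latticeType d) : Prop :=
  forall x y z : L, x `&` y = x `&` z -> x `&` (y `|` z) = x `&` y.

Definition semidistributive d (L : latticeType d) : Prop :=
  join_semidistributive L /\ meet_semidistributive L.

Definition principal_ideal d (P : finPOrderType d) (x : P) : {set P} :=
  [set y | y <= x].

(* A chain phi(0) = \bot < phi(1) < ... < phi(n) of n.+1 elements, indexed by
   'I_n.+1, so that its last element is phi ord_max. *)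
Record rooted_chain d (P : finBPOrderType d) (n : nat) := RootedChain {
  chain_fun :> 'I_n.+1 -> P;
  chain_bot : chain_fun ord0 = \bot;
  chain_lt : forall i j : 'I_n.+1, (i < j)%N -> chain_fun i < chain_fun j
}.

(* The underlying set of the disjoint union over k of
   principal_ideal (phi k) x {k}. *)
Definition chain_ideals d (P : finBPOrderType d) n (phi : rooted_chain P n) :
    {set P * 'I_n.+1} :=
  [set a | a.1 \in principal_ideal (phi a.2)].

Definition disj_union_le d (P : finBPOrderType d) n : rel (P * 'I_n.+1) :=
  fun a b => (a.2 == b.2) && (a.1 <= b.1).

Definition order_filter d (P : finBPOrderType d) n (phi : rooted_chain P n)
    (F : {set P * 'I_n.+1}) : bool :=
  (F \subset chain_ideals phi) &&
  [forall a in F, forall b in chain_ideals phi,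
     disj_union_le a b ==> (b \in F)].

(* Since i < j <= n, the ordinal inord i.+1 : 'I_n.+1 has value i.+1. *)
Definition torclosed d (P : finBPOrderType d) n (phi : rooted_chain P n)
    (F : {set P * 'I_n.+1}) : bool :=
  order_filter phi F &&
  [forall x : P, forall i : 'I_n.+1, forall j : 'I_n.+1,
     [&& (i < j)%N, (x, i) \in F & (phi (inord i.+1), j) \in F]
       ==> ((x, j) \in F)].

Record Tam d (P : finBPOrderType d) n (phi : rooted_chain P n) := MkTam {
  tam_set :> {set P * 'I_n.+1};
  tam_torclosed : torclosed phi tam_set
}.

HB.instance Definition _ d (P : finBPOrderType d) n (phi : rooted_chain P n) :=
  [isSub for @tam_set d P n phi].
HB.instance Definition _ d (P : finBPOrderType d) n (phi : rooted_chain P n) :=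
  [Finite of Tam phi by <:].

Lemma torclosedP d (P : finBPOrderType d) n (phi : rooted_chain P n)
    (F : {set P * 'I_n.+1}) :
  reflect
    [/\ forall x i, (x, i) \in F -> x <= phi i,
        forall x y i, (x, i) \in F -> x <= y -> y <= phi i -> (y, i) \in F &
        forall x (i j : 'I_n.+1), (i < j)%N -> (x, i) \in F ->
          (phi (inord i.+1), j) \in F -> (x, j) \in F]
    (torclosed phi F).
Proof.
apply: (iffP andP) => [[/andP[/subsetP sFC /'forall_implyP upF] /forallP torF]|].
  split=> [x i /sFC|x y i xiF xy yi|x i j ltij xiF pF]; first by rewrite !inE.
    have /'forall_implyP/(_ (y, i)) := upF _ xiF.
    by rewrite !inE /= => /(_ yi)/implyP; apply; rewrite /disj_union_le eqxx.
  have /forallP/(_ i)/forallP/(_ j)/implyP := torF x.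
  by apply; rewrite ltij xiF pF.
case=> sFC upF torF; split; last first.
  apply/forallP=> x; apply/forallP=> i; apply/forallP=> j.
  by apply/implyP=> /and3P[]; apply: torF.
apply/andP; split; first by apply/subsetP=> -[x i] /sFC; rewrite !inE.
apply/'forall_implyP=> -[x i] xiF; apply/'forall_implyP=> -[y j].
rewrite !inE /= => yj; apply/implyP=> /andP[/= /eqP eij xy]; subst j.
exact: upF xiF xy yj.
Qed.

Lemma torclosedI d (P : finBPOrderType d) n (phi : rooted_chain P n)
    (F G : {set P * 'I_n.+1}) :
  torclosed phi F -> torclosed phi G -> torclosed phi (F :&: G).
Proof.
move=> /torclosedP[sF uF tF] /torclosedP[sG uG tG]; apply/torclosedP; split.
- by move=> x i; rewrite inE => /andP[/sF].
- move=> x y i; rewrite !inE => /andP[xF xG] xy yi.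
  by apply/andP; split; [apply: uF xF xy yi | apply: uG xG xy yi].
- move=> x i j ltij; rewrite !inE => /andP[xF xG] /andP[pF pG].
  by apply/andP; split; [apply: tF ltij xF pF | apply: tG ltij xG pG].
Qed.

Lemma torclosed_chain_ideals d (P : finBPOrderType d) n
    (phi : rooted_chain P n) :
  torclosed phi (chain_ideals phi).
Proof.
apply/torclosedP; split=> [x i|x y i|x i j ltij]; rewrite !inE //=.
by move=> xi _; apply: le_trans xi (ltW (chain_lt phi ltij)).
Qed.

Definition tam_le d (P : finBPOrderType d) n (phi : rooted_chain P n) :
    rel (Tam phi) := fun F G => tam_set F \subset tam_set G.

Definition tam_meet d (P : finBPOrderType d) n (phi : rooted_chain P n)
    (F G : Tam phi) : Tam phi :=
  MkTam (torclosedI (tam_torclosed F) (tam_torclosed G)).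

Definition tam_top d (P : finBPOrderType d) n (phi : rooted_chain P n) :
    Tam phi := MkTam (torclosed_chain_ideals phi).

(* The intersection of all upper bounds of F and G. *)
Definition tam_join d (P : finBPOrderType d) n (phi : rooted_chain P n)
    (F G : Tam phi) : Tam phi :=
  \big[@tam_meet d P n phi/tam_top phi]_(H | tam_le F H && tam_le G H) H.

Lemma tam_le_refl d (P : finBPOrderType d) n (phi : rooted_chain P n) :
  reflexive (@tam_le d P n phi).
Proof. by move=> F; apply: subxx. Qed.

Lemma tam_le_anti d (P : finBPOrderType d) n (phi : rooted_chain P n) :
  antisymmetric (@tam_le d P n phi).
Proof. by move=> F G FG; apply/val_inj/eqP; rewrite eqEsubset. Qed.

Lemma tam_le_trans d (P : finBPOrderType d) n (phi : rooted_chain P n) :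
  transitive (@tam_le d P n phi).
Proof. by move=> G F H; apply: subset_trans. Qed.

HB.instance Definition _ d (P : finBPOrderType d) n (phi : rooted_chain P n) :=
  Order.Le_isPOrder.Build Order.SetSubsetOrder.subset_display (Tam phi)
    (@tam_le_refl d P n phi) (@tam_le_anti d P n phi) (@tam_le_trans d P n phi).

Lemma tam_meetP d (P : finBPOrderType d) n (phi : rooted_chain P n)
    (F G H : Tam phi) :
  (F <= tam_meet G H) = (F <= G) && (F <= H).
Proof. exact: subsetI. Qed.

Lemma tam_joinP d (P : finBPOrderType d) n (phi : rooted_chain P n)
    (F G H : Tam phi) :
  (tam_join F G <= H) = (F <= H) && (G <= H).
Proof.
have ub K : (K <= F) || (K <= G) -> K <= tam_join F G.
  move=> KFG; rewrite /tam_join; elim/big_ind: _ => [|A B KA KB|A /andP[FA GA]].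
  - by case/torclosedP: (valP K) => sK _ _; apply/subsetP=> -[x i] /sK; rewrite !inE.
  - by rewrite tam_meetP KA.
  - by case/orP: KFG => /le_trans; apply.
apply/idP/andP=> [le_H | [FH GH]].
  by split; apply: le_trans le_H; apply: ub; rewrite lexx ?orbT.
have : H \in index_enum (Tam phi) by rewrite mem_index_enum.
rewrite /tam_join; elim: (index_enum _) => // A s IHs.
rewrite inE big_cons => /predU1P[<-|/IHs le_H].
  have -> : tam_le F H && tam_le G H by apply/andP.
  exact: subsetIl.
by case: ifP => // _; apply: subset_trans le_H; apply: subsetIr.
Qed.

HB.instance Definition _ d (P : finBPOrderType d) n (phi : rooted_chain P n) :=
  Order.POrder_isMeetSemilattice.Build Order.SetSubsetOrder.subset_display
    (Tam phi) (@tam_meetP d P n phi).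
HB.instance Definition _ d (P : finBPOrderType d) n (phi : rooted_chain P n) :=
  Order.POrder_isJoinSemilattice.Build Order.SetSubsetOrder.subset_display
    (Tam phi) (@tam_joinP d P n phi).

Lemma tam_leE d (P : finBPOrderType d) n (phi : rooted_chain P n)
    (F G : Tam phi) : (F <= G) = (tam_set F \subset tam_set G).
Proof. by []. Qed.

Lemma tam_meetE d (P : finBPOrderType d) n (phi : rooted_chain P n)
    (F G : Tam phi) : tam_set (F `&` G) = tam_set F :&: tam_set G.
Proof. by []. Qed.

(* Main.v *)
(** Torclosedness never produces an element of level [j] from levels above [j],
    so removing elements of a single level can only break the condition at that
    level.  For join-semidistributivity of [x `|` y = x `|` z = w], put
    [u = x `|` (y `&` z)] and compare [w] and [u] level by level.  If they agree
    below level [j] and [y] has no new chain element [phi m] at level [j]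
    outside [u], then level [j] of [w] is that of [u] together with that of [y],
    and likewise for [z].  So the largest chain element of level [j] lying in
    [w] but not in [u] belongs to both [y] and [z], hence to [u]; thus there is
    none, and then every element of level [j] of [w] outside [u] belongs to
    both [y] and [z].

    If [x] is incomparable to [phi k.+1], meet-semidistributivity fails because
    level [k] and [(phi k.+1, ord_max)] together generate [(\bot, ord_max)],
    hence [(x, ord_max)]. *)
Require Import Defs.
From mathcomp Require Import all_boot all_order.

Set Implicit Arguments.
Unset Strict Implicit.
Unset Printing Implicit Defensive.

Import Order.TTheory.
Local Open Scope order_scope.

Section Tamari.

Variables (d : Order.disp_t) (P : finBPOrderType d) (n : nat).
Variable phi : rooted_chain P n.
Implicit Types (X Y Z U : Tam phi) (a b c x : P) (i j k m : 'I_n.+1).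

Lemma chain_le i j : (i <= j)%N -> phi i <= phi j.
Proof.
by rewrite leq_eqVlt => /predU1P[/val_inj->//|/(chain_lt phi)/ltW].
Qed.

Lemma tam_sub X a i : (a, i) \in tam_set X -> a <= phi i.
Proof. by case/torclosedP: (tam_torclosed X) => sX _ _; apply: sX. Qed.

Lemma tam_up X a b i :
  (a, i) \in tam_set X -> a <= b -> b <= phi i -> (b, i) \in tam_set X.
Proof. by case/torclosedP: (tam_torclosed X) => _ uX _; apply: uX. Qed.

Lemma tam_tor X a i j : (i < j)%N -> (a, i) \in tam_set X ->
  (phi (inord i.+1), j) \in tam_set X -> (a, j) \in tam_set X.
Proof. by case/torclosedP: (tam_torclosed X) => _ _ tX; apply: tX. Qed.

Lemma tam_leP X Y :
  reflect (forall a i, (a, i) \in tam_set X -> (a, i) \in tam_set Y) (X <= Y).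
Proof.
rewrite tam_leE; apply: (iffP subsetP) => [sXY a i|sXY [a i]]; exact: sXY.
Qed.

Lemma tam_join_subset X Y (T : {set P * 'I_n.+1}) : torclosed phi T ->
  tam_set X \subset T -> tam_set Y \subset T -> tam_set (X `|` Y) \subset T.
Proof.
move=> torT XT YT.
have : X `|` Y <= MkTam torT by rewrite leUx; apply/andP.
by [].
Qed.

(** Cutting level [j] of the join down to [U :|: Y] leaves a torclosed set [T]. Indeed, a torclosure
    step into level [j] combines a lower element, in [U] by [ltU], with a chain element, in [U] by
    [chainU], so its result is in [U]. *)
Lemma join_level X Y U j : X <= U ->
    (forall a i, (i < j)%N -> (a, i) \in tam_set (X `|` Y) ->
       (a, i) \in tam_set U) ->
    (forall m, (phi m, j) \in tam_set Y -> (phi m, j) \in tam_set U) ->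
  forall a, (a, j) \in tam_set (X `|` Y) ->
    (a, j) \in tam_set U :|: tam_set Y.
Proof.
move=> /tam_leP XU ltU chainU a aW.
pose T := [set p in tam_set (X `|` Y) |
             (p.2 == j) ==> (p \in tam_set U :|: tam_set Y)].
have /tam_leP XW : X <= X `|` Y by apply: leUl.
have /tam_leP YW : Y <= X `|` Y by apply: leUr.
have torT : torclosed phi T.
  apply/torclosedP; split=> [b i|b c i|b i k ltik].
  - by rewrite inE => /andP[/tam_sub].
  - rewrite !inE /= => /andP[bW bT] bc ci; rewrite (tam_up bW bc ci) /=.
    apply/implyP=> eij; move: bT; rewrite eij /=.
    by case/orP=> /tam_up/(_ bc ci)-> //; rewrite orbT.
  - rewrite !inE /= => /andP[bW _] /andP[pW pT].
    rewrite (tam_tor ltik bW pW) /=; apply/implyP=> /eqP ekj; subst k.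
    rewrite (tam_tor ltik (ltU _ _ ltik bW)) //.
    by move: pT; rewrite eqxx /= => /orP[|/chainU].
have : tam_set (X `|` Y) \subset T.
  apply: tam_join_subset => //; apply/subsetP=> -[b i] bi.
    by rewrite !inE /= (XW _ _ bi) (XU _ _ bi) implybT.
  by rewrite !inE /= (YW _ _ bi) bi orbT implybT.
by move/subsetP/(_ _ aW); rewrite inE aW /= eqxx.
Qed.

Lemma tam_join_semidistributive : join_semidistributive (Tam phi).
Proof.
move=> X Y Z eXYZ; apply/le_anti.
rewrite (leU2 (lexx X) (leIl Y Z)) /=; apply/tam_leP.
set U := X `|` (Y `&` Z).
have XU : X <= U by apply: leUl.
have /tam_leP YZU : Y `&` Z <= U by apply: leUr.
(* Strong induction on levels: [join_level] needs agreement on all lower ones. *)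
suff lvl l : forall a j, (j < l)%N ->
    (a, j) \in tam_set (X `|` Y) -> (a, j) \in tam_set U.
  by move=> a j; apply: (lvl j.+1).
elim: l => // l IHl.
move=> a j; rewrite ltnS => lejl.
have ltUY b i : (i < j)%N -> (b, i) \in tam_set (X `|` Y) ->
    (b, i) \in tam_set U by move=> /leq_trans/(_ lejl); apply: IHl.
have ltUZ b i : (i < j)%N -> (b, i) \in tam_set (X `|` Z) ->
    (b, i) \in tam_set U by rewrite -eXYZ; apply: ltUY.
have inU b : (b, j) \in tam_set Y -> (b, j) \in tam_set Z ->
    (b, j) \in tam_set U.
  by move=> bY bZ; apply: YZU; rewrite tam_meetE inE bY.
have /tam_leP YW : Y <= X `|` Y by apply: leUr.
have /tam_leP ZW : Z <= X `|` Y by rewrite eXYZ; apply: leUr.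
have chainU m : (phi m, j) \in tam_set (X `|` Y) -> (phi m, j) \in tam_set U.
  move=> mW; apply/negPn/negP=> mU.
  pose Q k := ((phi k, j) \in tam_set (X `|` Y))
              && ((phi k, j) \notin tam_set U).
  have Qm : Q m by rewrite /Q mW mU.
  case: (@arg_maxnP _ m Q val Qm) => k /andP[kW kU] kmax.
  (* Used for [S] equal to [Y] and to [Z]. By maximality of [k], any new chain element of [S] lies
     below [phi k], so up-closure would put [phi k] in [S]; without it, [join_level] applies and
     forces [phi k] into [U] or [S]. *)
  have kin S : S <= X `|` Y -> X `|` S = X `|` Y ->
      (phi k, j) \in tam_set S.
    move=> /tam_leP SW eS; apply/negPn/negP=> kS.
    suff : (phi k, j) \in tam_set U :|: tam_set S.
      by rewrite inE (negPf kU) (negPf kS).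
    apply: (join_level XU); rewrite ?eS // => i iS.
    apply/negPn/negP=> iU; case/negP: kS.
    apply: (tam_up iS); last exact: tam_sub kW.
    by apply/chain_le/kmax; rewrite /Q SW.
  case/negP: kU; apply: inU; apply: kin => //; last by rewrite eXYZ leUr.
  exact: leUr.
move=> aW; apply/negPn/negP=> aU; case/negP: (aU); apply: inU.
- have := join_level XU ltUY (fun m mY => chainU m (YW _ _ mY)) aW.
  by rewrite inE (negPf aU).
- rewrite eXYZ in aW.
  have := join_level XU ltUZ (fun m mZ => chainU m (ZW _ _ mZ)) aW.
  by rewrite inE (negPf aU).
Qed.

Lemma comparable_meet_semidistributive :
    (forall x, x <= phi ord_max -> forall k, x >=< phi k) ->
  meet_semidistributive (Tam phi).
Proof.
move=> cmp X Y Z eXYZ; apply/le_anti/andP; split; last first.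
  by rewrite leI2 ?leUl.
pose W := X `&` Y.
(* [(a, i)] generates [(a, j)], hence [(c, j)] for [c >= a], in any member of
   [Tam phi] containing [(phi i.+1, j)].  [V] consists of the [(a, i)] for which
   every [(c, j)] in [X] obtained this way with [(phi i.+1, j)] in [W] is
   already in [W]: this makes [V] contain both [Y] and [Z], while [X] meets [V]
   inside [W]. *)
pose V := [set p : P * 'I_n.+1 | (p.1 <= phi p.2) &&
  [forall c : P, forall j : 'I_n.+1,
     [&& p.1 <= c, (c, j) \in tam_set X &
         (j == p.2) || ((p.2 < j)%N &&
                        ((phi (inord p.2.+1), j) \in tam_set W))]
     ==> ((c, j) \in tam_set W)]].
have VP a i : reflect (a <= phi i /\ forall c j, a <= c ->
    (c, j) \in tam_set X ->
    j = i \/ (i < j)%N /\ (phi (inord i.+1), j) \in tam_set W ->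
    (c, j) \in tam_set W) ((a, i) \in V).
  rewrite inE /=; apply: (iffP andP) => -[ai aV]; split=> //.
    move=> c j ac cX H; move/forallP/(_ c)/forallP/(_ j)/implyP: aV; apply.
    by rewrite ac cX /=; case: H => [->|[-> ->]]; rewrite ?eqxx ?orbT.
  apply/forallP=> c; apply/forallP=> j; apply/implyP=> /and3P[ac cX H].
  apply: aV => //; case/orP: H => [/eqP|/andP[]]; [by left|by right].
have subV S : W = X `&` S -> tam_set S \subset V.
  move=> eW; apply/subsetP=> -[a i] aS; apply/VP.
  split; first exact: tam_sub aS.
  move=> c j ac cX H; rewrite eW tam_meetE inE cX /=.
  have aj : (a, j) \in tam_set S.
    case: H => [->//|[ltij]]; rewrite eW tam_meetE inE => /andP[_].
    exact: tam_tor aS.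
  exact: tam_up aj ac (tam_sub cX).
have torV : torclosed phi V.
  apply/torclosedP; split=> [a i /VP[]//|a b i /VP[_ aV] ab bi|a i k ltik].
    by apply/VP; split=> // c j bc; apply/aV/(le_trans ab bc).
  move=> /VP[ai aV] /VP[pk pV]; apply/VP; split.
    exact: le_trans ai (chain_le (ltnW ltik)).
  move=> c j ac cX H.
  have lekj : (k <= j)%N by case: H => [->|[/ltnW]].
  (* If [c] is below [phi i.+1], then [(phi i.+1, j)] is in [X], so [pV] puts it in [W] and [aV]
     becomes applicable to [c]. If [c] is above, [pV] applies to [c] directly. *)
  have /orP[cp|pc] : c >=< phi (inord i.+1).
    apply: cmp; apply: le_trans (tam_sub cX) _.
    exact: (@chain_le j ord_max (leq_ord j)).
    have pj : phi (inord i.+1) <= phi j by apply: le_trans pk (chain_le lekj).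
    apply: aV => //; right; split; first exact: leq_trans ltik lekj.
    by apply: pV => //; apply: tam_up cX cp pj.
  exact: pV.
have /subsetP YZV := tam_join_subset torV (subV Y erefl) (subV Z eXYZ).
apply/tam_leP=> a i; rewrite tam_meetE inE => /andP[aX /YZV/VP[_ aV]].
by apply: aV => //; left.
Qed.

(** The failing triple has [X] and [Z] generated by [x] and [phi k] in the last level, and [Y] made
    of level [k.-1] and [X :&: Z]. *)
Lemma meet_semidistributive_comparable : meet_semidistributive (Tam phi) ->
  forall x, x <= phi ord_max -> forall k, x >=< phi k.
Proof.
move=> msd x xN k; apply/negPn/negP=> ncmp.
have k_gt0 : (0 < k)%N.
  rewrite lt0n; apply/eqP=> k0; case/negP: ncmp.
  have -> : k = ord0 by apply: val_inj.
  by rewrite chain_bot comparable_sym /Order.comparable le0x.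
have k_ltn : (k < n)%N.
  rewrite ltn_neqAle leq_ord andbT; apply/eqP=> kn; case/negP: ncmp.
  have -> : k = ord_max by apply: val_inj.
  by rewrite /Order.comparable xN.
have nxk : ~~ (x <= phi k).
  by apply: contra ncmp => xk; rewrite /Order.comparable xk.
(* Torclosure steps out of level [i] are then triggered by [phi k]. *)
pose i : 'I_n.+1 := inord k.-1.
have vi : i = k.-1 :> nat by rewrite inordK // ltnW // prednK // ltnW.
have ei : inord i.+1 = k by apply: val_inj; rewrite vi prednK // inord_val.
have neq_iN : (i == ord_max) = false.
  apply/eqP=> /(congr1 val) /=; rewrite vi => ein.
  by have := leq_pred k; rewrite ein leqNgt k_ltn.
pose up b := [set p : P * 'I_n.+1 |
  [&& p.2 == ord_max, p.1 <= phi ord_max & b <= p.1]].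
have tor_up b : torclosed phi (up b).
  apply/torclosedP; split=> [a j|a c j|a j l ltjl]; rewrite !inE /=.
  - by case/and3P=> /eqP->.
  - move=> /and3P[/eqP-> _ ba] ac -> /=; rewrite eqxx /=; exact: le_trans ac.
  - by case/and3P=> /eqP ej; move: ltjl; rewrite ej ltnNge leq_ord.
pose low := [set p : P * 'I_n.+1 |
  ((p.2 == i) && (p.1 <= phi i)) || (p \in up x) && (p \in up (phi k))].
have tor_low : torclosed phi low.
  apply/torclosedP; split=> [a j|a c j|a j l ltjl]; rewrite !inE /=.
  - by case/orP=> [/andP[/eqP->]|/andP[/and3P[/eqP->]]].
  - case/orP=> [/andP[/eqP-> _] _ ->|]; first by rewrite eqxx.
    move=> /andP[/and3P[/eqP-> _ xa] /and3P[_ _ ka]] ac -> /=.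
    by rewrite eqxx (le_trans xa ac) (le_trans ka ac) orbT.
  - case/orP=> [/andP[/eqP ej _]|/andP[/and3P[/eqP ej _ _] _]]; last first.
      by move: ltjl; rewrite ej ltnNge leq_ord.
    rewrite ej ei in ltjl *.
    (* A step from level [i] to the last one would need [phi k] in [up x], against [nxk]. *)
    case/orP=> [/andP[/eqP el _]|/andP[/and3P[_ _]]].
      by move: ltjl; rewrite el ltnn.
    by rewrite (negPf nxk).
pose X := MkTam (tor_up x); pose Z := MkTam (tor_up (phi k)).
pose Y := MkTam tor_low.
have eXYZ : X `&` Y = X `&` Z.
  apply/val_inj/setP=> -[a j]; rewrite /= !inE /=.
  have [->|//] := eqVneq j ord_max.
  by rewrite eq_sym neq_iN /=; case: (a <= _); case: (x <= a).
have /tam_leP YW : Y <= Y `|` Z by apply: leUl.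
have /tam_leP ZW : Z <= Y `|` Z by apply: leUr.
have botW : (\bot, ord_max) \in tam_set (Y `|` Z).
  apply: (@tam_tor _ _ i).
  - by rewrite ltn_neqAle leq_ord andbT -[_ == _]/(i == ord_max) neq_iN.
  - by apply: YW; rewrite !inE /= eqxx le0x.
  - by apply: ZW; rewrite ei !inE /= eqxx lexx andbT; apply/chain_le/leq_ord.
have xW : (x, ord_max) \in tam_set (Y `|` Z) by apply: tam_up botW (le0x x) xN.
have : (x, ord_max) \in tam_set (X `&` (Y `|` Z)).
  by rewrite tam_meetE inE xW andbT !inE /= eqxx xN lexx.
rewrite (msd _ _ _ eXYZ) eXYZ tam_meetE !inE /= => /andP[_ /and3P[_ _ kx]].
by case/negP: ncmp; rewrite /Order.comparable kx orbT.
Qed.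

End Tamari.

Theorem proposition4p6 (d : Order.disp_t) (P : finBPOrderType d) (n : nat)
    (phi : rooted_chain P n) :
  join_semidistributive (Tam phi) /\
  (semidistributive (Tam phi) <->
   forall x : P, x \in principal_ideal (phi ord_max) ->
     forall k : 'I_n.+1, x >=< phi k).
Proof.
split; first exact: tam_join_semidistributive.
split=> [[_ msd] x|cmp].
  by rewrite inE; apply: meet_semidistributive_comparable.
split; first exact: tam_join_semidistributive.
by apply: comparable_meet_semidistributive => x xN; apply: cmp; rewrite inE.
Qed.
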